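(* Let $G=(V,E)$ be a finite simple graph and let $C\subseteq V$ be a minimum vertex cover of $G$. Then $G$ is of class two if and only if for any two (not necessarily distinct) nonempty independent sets $S,T\subseteq C$ we have $|N_{V-C}(S)\cap N_{V-C}(T)|>|S|+|T|$.
   Context: For $X\subseteq V$, $N(X)$ is the union of neighborhoods of vertices of $X$ and $N_S(X)=N(X)\cap S$. $\beta(G)$ is the size of a minimum vertex cover. Alcuin problem: the vertices of $G$ are items initially on the left bank of a river; a man with a boat of capacity $b$ (a positive integer) must carry them all to the right bank so that no two adjacent vertices are ever left together on a bank. Formally, a feasible schedule for capacity $b$ is a sequence of triples $(L_k,B_k,R_k)$, $k=1,\dots,s$, $s$ odd, such that: each triple is a partition of $V$; $L_k$ and $R_k$ are independent sets; $|B_k|\le b$; $L_1\cup B_1=V$; $B_s\cup R_s=V$; for even $k$, $L_k=L_{k-1}$ and $B_k\cup R_k=B_{k-1}\cup R_{k-1}$; for odd $k\ge 3$, $R_k=R_{k-1}$ and $B_k\cup L_k=B_{k-1}\cup L_{k-1}$. The Alcuin number $c(G)$ is the least positive integer $b$ for which a feasible schedule exists. One always has $\beta(G)\le c(G)\le \beta(G)+1$; $G$ is of class one if $c(G)=\beta(G)$ and of class two if $c(G)=\beta(G)+1$. *)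

(* Defs.v *)
From mathcomp Require Import all_boot.
From mathcomp Require Import boolp.

Set Implicit Arguments.
Unset Strict Implicit.
Unset Printing Implicit Defensive.

(* A finite simple graph is a finType V of vertices with an adjacency relation
   e : rel V, assumed symmetric and irreflexive in the theorems. *)
Section Alcuin.
Variables (V : finType) (e : rel V).

Definition independent (A : {set V}) : bool :=
  [forall x in A, forall y in A, ~~ e x y].

Definition vertex_cover (A : {set V}) : bool :=
  [forall x, forall y, e x y ==> (x \in A) || (y \in A)].

Definition min_vertex_cover (A : {set V}) : bool :=
  vertex_cover A && [forall D, vertex_cover D ==> (#|A| <= #|D|)].

(* The default value setT is always a vertex cover. *)
Definition cover_number : nat :=
  #|[arg min_(A < [set: V] | vertex_cover A) #|A| ]|.

Definition nbhd (X : {set V}) : {set V} := \bigcup_(x in X) [set y | e x y].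

Definition nbhd_in (S X : {set V}) : {set V} := nbhd X :&: S.

(* Parts may be empty, hence not finset's [partition]. *)
Definition tripartition (L B R : {set V}) : Prop :=
  [/\ L :|: B :|: R = [set: V],
      [disjoint L & B], [disjoint L & R] & [disjoint B & R]].

(* Only the values of L, B, R at the indices 1, ..., s are constrained. *)
Definition feasible_schedule (b s : nat) (L B R : nat -> {set V}) : Prop :=
  [/\ odd s,
      forall k, 1 <= k <= s ->
        [/\ tripartition (L k) (B k) (R k),
            independent (L k), independent (R k) & #|B k| <= b],
      L 1 :|: B 1 = [set: V] /\ B s :|: R s = [set: V],
      forall k, 2 <= k <= s -> ~~ odd k ->
        L k = L k.-1 /\ B k :|: R k = B k.-1 :|: R k.-1
    & forall k, 3 <= k <= s -> odd k ->
        R k = R k.-1 /\ B k :|: L k = B k.-1 :|: L k.-1].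

Definition feasible (b : nat) : Prop :=
  exists s L B R, feasible_schedule b s L B R.

Lemma feasible_capacity_exists : exists b, (0 < b) && `[< feasible b >].
Proof.
exists #|V|.+1; apply/andP; split=> //; apply/asboolP.
exists 1, (fun=> set0), (fun=> setT), (fun=> set0); split.
- by [].
- move=> k _; split.
  + by split; rewrite ?set0U ?setU0 // -setI_eq0 ?set0I ?setI0.
  + by apply/forall_inP => x; rewrite inE.
  + by apply/forall_inP => x; rewrite inE.
  + by rewrite cardsT leqnSn.
- by rewrite set0U setU0.
- by move=> k; case: k => [|[|k]].
- by move=> k; case: k => [|[|[|k]]].
Qed.

Definition alcuin_number : nat := ex_minn feasible_capacity_exists.

Definition class_two : Prop := alcuin_number = cover_number.+1.

End Alcuin.

(* Main.v *)
Require Import Defs.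
From mathcomp Require Import all_boot.
From mathcomp Require Import boolp.
From mathcomp Require Import zify.

(* With a boat of capacity [#|C|], a set [S] of [C] left on a bank frees [#|S|]
   places, which can carry the neighbours of [S]. A set of the items outside [C]
   can thus be moved to the right bank using [S], and the remaining ones, read
   backwards in time, using [T], as soon as the common neighbours of [S] and [T]
   can be shared between the two. Conversely, in a schedule of capacity [#|C|],
   [S] and [T] are the parts of the cover lying on the banks, and the first time
   an item of the cover is left on the left bank yields the inequality. The
   cover is then the first boat load [B 1] rather than [C]; if the two differ,
   [S = T = C :\: B 1] satisfies the inequality anyway. *)

Section Graph.
Variables (V : finType) (e : rel V).
Hypothesis e_sym : symmetric e.
Implicit Types (A C D L R S T W X Y Z : {set V}) (p q : {set V} * {set V}).

(** * Independent sets, vertex covers and neighbourhoods *)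

Lemma independentP A :
  reflect {in A &, forall x y, ~~ e x y} (independent e A).
Proof.
apply: (iffP forall_inP) => [h x y xA yA|h x xA]; first exact: (forall_inP (h x xA)).
by apply/forall_inP => y; apply: h.
Qed.

Lemma independent0 : independent e set0.
Proof. by apply/independentP => x y; rewrite inE. Qed.

Lemma independentS A D : A \subset D -> independent e D -> independent e A.
Proof.
move=> /subsetP AD /independentP iD; apply/independentP => x y xA yA.
by apply: iD; apply: AD.
Qed.

Lemma vertex_cover_indepC C : vertex_cover e C = independent e (~: C).
Proof.
apply/forallP/independentP => [h x y|h x].
  rewrite !inE => xC yC; apply/negP => exy.
  by have /forallP/(_ y) := h x; rewrite exy (negbTE xC) (negbTE yC).
apply/forallP => y; apply/implyP; apply: contraLR; rewrite negb_or => /andP[xC yC].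
by apply: h; rewrite inE.
Qed.

Lemma min_vertex_coverP C :
  reflect (vertex_cover e C /\ forall D, vertex_cover e D -> #|C| <= #|D|)
          (min_vertex_cover e C).
Proof.
apply: (iffP andP) => -[vC h]; split=> //.
  by move=> D vD; move: (forallP h D); rewrite vD.
by apply/forallP => D; apply/implyP; apply: h.
Qed.

Lemma card_min_vertex_cover C : min_vertex_cover e C -> cover_number e = #|C|.
Proof.
move=> /min_vertex_coverP[vC minC]; rewrite /cover_number.
case: arg_minnP => [|D vD minD].
  by rewrite vertex_cover_indepC setCT independent0.
by apply/eqP; rewrite eqn_leq minC // minD.
Qed.

Lemma nbhdP X y : reflect (exists2 x, x \in X & e x y) (y \in nbhd e X).
Proof.
by apply: (iffP bigcupP) => -[x xX]; [rewrite inE|]; exists x => //; rewrite inE.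
Qed.

Lemma independent_nbhd X y : independent e X -> y \in X -> y \notin nbhd e X.
Proof.
move=> /independentP iX yX; apply/negP => /nbhdP[x xX exy].
by move: (iX x y xX yX); rewrite exy.
Qed.

Lemma independentU A D :
  independent e A -> independent e D -> [disjoint nbhd e A & D] ->
  independent e (A :|: D).
Proof.
move=> /independentP iA /independentP iD /pred0P dAD.
have nAD x y : x \in A -> y \in D -> ~~ e x y.
  move=> xA yD; apply/negP => exy; have := dAD y; rewrite /= yD andbT.
  by move/negP; apply; apply/nbhdP; exists x.
apply/independentP => x y; rewrite !inE => /orP[xA|xD] /orP[yA|yD].
- exact: iA.
- exact: nAD.
- by rewrite e_sym nAD.
- exact: iD.
Qed.

Lemma independent1 x : irreflexive e -> independent e [set x].
Proof. by move=> eI; apply/independentP => y z /set1P-> /set1P->; rewrite eI. Qed.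

(** * The negated criterion and its division between two sets *)

Definition tight C : Prop :=
  exists S T, [/\ (S != set0) && (T != set0), (S \subset C) && (T \subset C),
    independent e S, independent e T
    & #|nbhd_in e (~: C) S :&: nbhd_in e (~: C) T| <= #|S| + #|T|].

(* With [Y] left behind on a bank, the whole of [A] can be brought to that bank
   using a boat of capacity [#|C|]: the part of [A] adjacent to [Y] takes the
   places of [Y] in the boat. *)
Definition clears C Y A : Prop :=
  [/\ Y != set0, Y \subset C, independent e Y & #|nbhd e Y :&: A| <= #|Y|].

(** A common neighbour of [S] and [T] outside [C] lies in [A] or in [~: C :\: A], so one of the two
    bounds counts it. *)
Lemma clears_tight C A S T :
  clears C S A -> clears C T (~: C :\: A) -> tight C.
Proof.
move=> [S0 SC iS cS] [T0 TC iT cT]; exists S, T; split=> //; rewrite ?S0 ?SC //.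
apply: leq_trans (leq_add cS cT); apply: leq_trans (leq_card_setU _ _).
apply/subset_leq_card/subsetP => x; rewrite !inE.
by do 4!case: (_ \in _).
Qed.

(** [A] consists of the non-neighbours of [S] outside [C] and of as many common neighbours as [#|S|]
    allows; at most [#|T|] common neighbours then remain for [T]. *)
Lemma tight_clears C : tight C ->
  exists S T A, [/\ A \subset ~: C, clears C S A & clears C T (~: C :\: A)].
Proof.
move=> [S [T [/andP[S0 T0] /andP[SC TC] iS iT cST]]].
set Z := _ :&: _ in cST.
have [Z' Z'Z cZ'] : exists2 Z' : {set V}, Z' \subset Z & #|Z'| = minn #|S| #|Z|.
  have : 0 < #|[set A : {set V} | (A \subset Z) && (#|A| == minn #|S| #|Z|)]|.
    by rewrite cards_draws bin_gt0 geq_minr.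
  by move=> /card_gt0P[Z']; rewrite inE => /andP[? /eqP]; exists Z'.
exists S, T, ((~: C :\: nbhd e S) :|: Z'); split.
- apply/subsetP => x; rewrite !inE => /orP[/andP[]//|/(subsetP Z'Z)].
  by rewrite !inE => /andP[/andP[]].
- split=> //; apply: leq_trans (_ : #|Z'| <= _); last by rewrite cZ' geq_minl.
  apply/subset_leq_card/subsetP => x; rewrite !inE.
  by case: (x \in nbhd e S).
- split=> //; apply: leq_trans (_ : #|Z :\: Z'| <= _).
    apply/subset_leq_card/subsetP => x; rewrite !inE negb_or negb_and negbK.
    by do 4!case: (_ \in _).
  by rewrite cardsDS //; lia.
Qed.

(* For two distinct minimum vertex covers the neighbours of [C :\: D] outside [C]
   lie in [D :\: C], which has as many elements as [C :\: D]. *)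
Lemma tight_transfer C D :
  min_vertex_cover e C -> min_vertex_cover e D -> tight D -> tight C.
Proof.
move=> /min_vertex_coverP[vC mC] /min_vertex_coverP[vD mD].
have cCD : #|C| = #|D| by apply/eqP; rewrite eqn_leq mC ?mD.
have [->//|neCD _] := eqVneq C D.
have cdif : #|C :\: D| = #|D :\: C|.
  by move: (cardsID D C) (cardsID C D); rewrite setIC; lia.
have iCD : independent e (C :\: D).
  move: vD; rewrite vertex_cover_indepC; apply: independentS.
  by apply/subsetP => x; rewrite !inE => /andP[].
exists (C :\: D), (C :\: D); split; rewrite ?subsetDl //.
  rewrite andbb -card_gt0 lt0n; apply: contra neCD => /eqP c0.
  by rewrite eqEcard cCD leqnn andbT -setD_eq0 -cards_eq0 c0.
rewrite setIid; apply: leq_trans (leq_addr _ _); rewrite cdif.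
apply/subset_leq_card/subsetP => y; rewrite !inE => /andP[/nbhdP[x]].
rewrite !inE => /andP[xD xC] exy ->; have /forallP/(_ x)/forallP/(_ y) := vD.
by rewrite exy (negbTE xD).
Qed.

(** * Positions, reversible steps and schedules *)

(** A position is the pair of left and right banks; the boat carries all other items. *)
Definition legal b p : bool :=
  [&& [disjoint p.1 & p.2], independent e p.1, independent e p.2
    & #|~: (p.1 :|: p.2)| <= b].

Definition step b : rel ({set V} * {set V}) := fun p q =>
  [&& legal b p, legal b q & (p.1 == q.1) || (p.2 == q.2)].

(* A step changing one bank only takes at most two crossings; between the two,
   the position is [(p.1, q.2)], which is [p] or [q]. *)
Lemma connect_feasible b L R :
  legal b (L, set0) -> connect (step b) (L, set0) (set0, R) -> feasible e b.
Proof.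
move=> l0 /connectP[ps pth lst].
pose P i := nth (L, set0) ((L, set0) :: ps) i.
have Pstep i : i < size ps -> step b (P i) (P i.+1).
  by move=> ilt; apply: (pathP (L, set0) pth i ilt).
have Plegal i : i <= size ps -> legal b (P i).
  by case: i => [|i] // /Pstep /and3P[].
have Pmid i : i < size ps -> legal b ((P i).1, (P i.+1).2).
  move=> /Pstep; case: (P i) (P i.+1) => [a1 a2] [b1 b2] /and3P[/= la lb].
  by case/orP => /eqP h; rewrite ?h // -h.
(* Index [2i+1] shows [P i]; index [2i+2] has the left bank of [P i] and the right bank of
   [P i.+1]. *)
pose Lk k := (P k.-1./2).1; pose Rk k := (P k./2).2.
have Lk_even k : 2 <= k -> ~~ odd k -> Lk k = Lk k.-1.
  by move=> k2 ko; rewrite /Lk; congr (P _).1; lia.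
have Rk_odd k : 3 <= k -> odd k -> Rk k = Rk k.-1.
  by move=> k2 ko; rewrite /Rk; congr (P _).2; lia.
pose Bk k := ~: (Lk k :|: Rk k).
have klegal k : 1 <= k <= (size ps).*2.+1 -> legal b (Lk k, Rk k).
  move=> hk; rewrite /Lk /Rk; have [ko|ke] := boolP (odd k).
    have -> : k.-1./2 = k./2 by lia.
    by rewrite -surjective_pairing; apply: Plegal; lia.
  have -> : k./2 = k.-1./2.+1 by lia.
  by apply: Pmid; lia.
have kdis k : 1 <= k <= (size ps).*2.+1 -> forall x, ~~ ((x \in Lk k) && (x \in Rk k)).
  by move=> /klegal /and4P[/pred0P dLR _ _ _] x; apply/negbT/dLR.
exists (size ps).*2.+1, Lk, Bk, Rk; split.
- by rewrite /= odd_double.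
- move=> k hk; have /and4P[/= dLR iL iR cB] := klegal k hk; split=> //; split=> //.
  + by apply/setP => x; rewrite !inE; do 2!case: (_ \in _).
  + by apply/pred0P => x; rewrite /= !inE; do 2!case: (_ \in _).
  + by apply/pred0P => x; rewrite /= !inE; do 2!case: (_ \in _).
- split; apply/setP => x; rewrite !inE.
    by rewrite orbF orbN.
  have -> : Lk (size ps).*2.+1 = set0.
    by rewrite /Lk /= doubleK /P nth_last /= -lst.
  by rewrite inE orNb.
- move=> k hk ke; have E : Lk k = Lk k.-1 by apply: Lk_even; lia.
  have hk1 : 1 <= k.-1 <= (size ps).*2.+1 by lia.
  have hk0 : 1 <= k <= (size ps).*2.+1 by lia.
  split=> //; apply/setP => x; move: (kdis k hk0 x) (kdis k.-1 hk1 x).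
  by rewrite !inE E; case: (x \in Lk _); do 2!case: (x \in Rk _).
- move=> k hk ke; have E : Rk k = Rk k.-1 by apply: Rk_odd; lia.
  have hk1 : 1 <= k.-1 <= (size ps).*2.+1 by lia.
  have hk0 : 1 <= k <= (size ps).*2.+1 by lia.
  split=> //; apply/setP => x; move: (kdis k hk0 x) (kdis k.-1 hk1 x).
  by rewrite !inE E; case: (x \in Rk _); do 2!case: (x \in Lk _).
Qed.

Definition swap p := (p.2, p.1).

Lemma legal_swap b p : legal b (swap p) = legal b p.
Proof.
rewrite /legal /= disjoint_sym setUC.
by case: [disjoint _ & _] => //=; rewrite andbCA.
Qed.

Lemma step_sym b : symmetric (step b).
Proof.
by move=> p q; rewrite /step andbCA (eq_sym p.1) (eq_sym p.2).
Qed.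

(** Time reversal: [step] is symmetric, so a run read backwards with the banks exchanged is again a
    run. *)
Lemma connect_swap b p q :
  connect (step b) p q -> connect (step b) (swap q) (swap p).
Proof.
move=> /connectP[ps]; elim: ps p => [|r ps IH] p /=; first by move=> _ ->.
move=> /andP[pr prs] lst; apply: connect_trans (IH r prs lst) _.
apply: connect1; move: pr; rewrite step_sym /step !legal_swap /=.
by rewrite orbC.
Qed.

(** * Building schedules from a vertex cover *)

Lemma legal_cover b C S W Z :
  vertex_cover e C -> S \subset C -> independent e S ->
  W \subset ~: C -> Z \subset ~: C -> [disjoint W & Z] ->
  [disjoint nbhd e S & W] -> #|C :\: S| + #|~: C :\: (W :|: Z)| <= b ->
  legal b (Z, S :|: W).
Proof.
rewrite vertex_cover_indepC => iC /subsetP SC iS WC ZC dWZ dSW cb.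
apply/and4P; split=> /=.
- apply/pred0P => x /=; apply/negP => /andP[xZ]; rewrite inE => /orP[/SC xC|xW].
    by have := subsetP ZC x xZ; rewrite inE xC.
  by have := pred0P dWZ x; rewrite /= xW xZ.
- exact: independentS ZC iC.
- by apply: independentU => //; apply: independentS WC iC.
- apply: leq_trans cb; apply: leq_trans (leq_card_setU _ _).
  apply/subset_leq_card/subsetP => x; rewrite !inE.
  by do 4!case: (_ \in _).
Qed.

(** A place stays free beside [C :\: S], so the items of [W] cross one at a time, each first leaving
    the left bank and then landing on the right. *)
Lemma connect_carry b C S W :
  vertex_cover e C -> S \subset C -> independent e S -> #|C :\: S| < b ->
  W \subset ~: C -> [disjoint nbhd e S & W] ->
  connect (step b) (~: C, S) (~: C :\: W, S :|: W).
Proof.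
move=> vC SC iS cb; elim: {W}#|W| {-2}W (erefl #|W|) => [|n IH] W cW WC dW.
  by rewrite (cards0_eq cW) setD0 setU0 connect0.
have [x xW] : exists x, x \in W by apply/card_gt0P; rewrite cW.
have W'W : W :\ x \subset W by rewrite subsetDl.
have dW' : [disjoint nbhd e S & W :\ x] by apply: disjointWr W'W dW.
have W'C := subset_trans W'W WC.
have lg Y Z : Y \subset W -> Z \subset ~: C -> [disjoint Y & Z] ->
    #|~: C :\: (Y :|: Z)| <= 1 -> legal b (Z, S :|: Y).
  move=> YW ZC dYZ c1; apply: (legal_cover b C) => //.
  - exact: subset_trans YW WC.
  - exact: disjointWr YW dW.
  - by rewrite (leq_trans _ cb) // -addn1 leq_add2l.
have dis A Y : [disjoint A & Y :\: A].
  by apply/pred0P => y; rewrite /= !inE; case: (_ \in _).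
have UD Y Z : #|~: C :\: (Y :|: (~: C :\: Z))| <= #|Z :\: Y|.
  apply/subset_leq_card/subsetP => y; rewrite !inE.
  by do 3!case: (_ \in _).
have lA : legal b (~: C :\: (W :\ x), S :|: W :\ x).
  apply: lg; rewrite ?subsetDl //.
  by apply: leq_trans (UD _ _) _; rewrite setDv cards0.
have lB : legal b (~: C :\: W, S :|: W :\ x).
  apply: lg; rewrite ?subsetDl //; first by apply: disjointWl W'W (dis _ _).
  apply: leq_trans (UD _ _) _.
  by rewrite cardsDS //; have := cardsD1 x W; rewrite xW; lia.
have lD : legal b (~: C :\: W, S :|: W).
  apply: lg; rewrite ?subsetDl //.
  by apply: leq_trans (UD _ _) _; rewrite setDv cards0.
apply: connect_trans (IH (W :\ x) _ W'C dW') _.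
  by have := cardsD1 x W; rewrite xW cW => -[].
apply: (@connect_trans _ _ (~: C :\: W, S :|: W :\ x)); apply: connect1.
  by rewrite /step lA lB eqxx orbT.
by rewrite /step lB lD eqxx.
Qed.

Lemma legal_start C : vertex_cover e C -> legal #|C| (~: C, set0).
Proof.
move=> vC; rewrite /legal -setI_eq0 setI0 eqxx independent0 setU0 setCK leqnn.
by rewrite -vertex_cover_indepC vC.
Qed.

(** Four stages: [Y] lands on the right; the items of [A] not adjacent to [Y] cross one by one; the
    other items of [A] board in the places freed by [Y]; on the right bank they are exchanged for
    [Y]. *)
Lemma clears_connect C Y A : vertex_cover e C -> A \subset ~: C -> clears C Y A ->
  connect (step #|C|) (~: C, set0) (~: C :\: A, A).
Proof.
move=> vC AC [Y0 YC iY cY]; pose W := A :\: nbhd e Y.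
have WC : W \subset ~: C by apply: subset_trans AC; rewrite subsetDl.
have dW : [disjoint nbhd e Y & W].
  by apply/pred0P => y; rewrite /= !inE; case: (_ \in nbhd _ _).
have cCY : #|C :\: Y| + #|Y| = #|C|.
  by rewrite cardsDS // subnK // subset_leq_card.
have Ypos : 0 < #|Y| by rewrite card_gt0.
have dis Z Z' : [disjoint Z & Z' :\: Z].
  by apply/pred0P => y; rewrite /= !inE; case: (_ \in _).
have lY : legal #|C| (~: C, Y).
  rewrite -[Y]setU0; apply: (legal_cover _ C);
    rewrite -?setI_eq0 ?set0I ?setI0 ?sub0set //.
  by rewrite set0U setDv cards0; lia.
have lW : legal #|C| (~: C :\: W, Y :|: W).
  apply: (legal_cover _ C); rewrite ?subsetDl //.
  have -> : ~: C :\: (W :|: (~: C :\: W)) = set0.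
    by apply/setP => y; rewrite !inE; do 3!case: (_ \in _).
  by rewrite cards0; lia.
have lA : legal #|C| (~: C :\: A, Y :|: W).
  apply: (legal_cover _ C); rewrite ?subsetDl //.
    by apply: disjointWl (dis _ _); rewrite subsetDl.
  apply: leq_trans (_ : #|C :\: Y| + #|nbhd e Y :&: A| <= _); last lia.
  rewrite leq_add2l; apply/subset_leq_card/subsetP => y; rewrite !inE.
  by do 3!case: (_ \in _).
have lE : legal #|C| (~: C :\: A, A).
  rewrite -{2}[A]set0U; apply: (legal_cover _ C);
    rewrite ?sub0set ?independent0 ?subsetDl //.
    by apply/pred0P => y /=; apply/negP => /andP[/nbhdP[z]]; rewrite inE.
  have -> : ~: C :\: (A :|: (~: C :\: A)) = set0.
    by apply/setP => y; rewrite !inE; do 2!case: (_ \in _).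
  by rewrite cards0 setD0 addn0.
apply: (@connect_trans _ _ (~: C, Y)).
  by apply: connect1; rewrite /step legal_start // lY eqxx.
apply: (@connect_trans _ _ (~: C :\: W, Y :|: W)).
  by apply: connect_carry => //; lia.
apply: (@connect_trans _ _ (~: C :\: A, Y :|: W)); apply: connect1.
  by rewrite /step lW lA eqxx orbT.
by rewrite /step lA lE eqxx.
Qed.

Lemma tight_feasible C : vertex_cover e C -> tight C -> feasible e #|C|.
Proof.
move=> vC /tight_clears[S [T [A [AC cS cT]]]].
apply: (@connect_feasible _ (~: C) (~: C)); first exact: legal_start.
apply: connect_trans (clears_connect _ _ _ vC AC cS) _.
(* The second half is the run with [T] that carries [~: C :\: A], reversed in time. *)
have := connect_swap _ _ _ (clears_connect _ _ _ vC (subsetDl _ _) cT).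
by rewrite /swap /= setDDr setDv set0U (setIidPr AC).
Qed.

(** All of [C] stays in the boat while the spare place ferries the other items. *)
Lemma cover_feasibleS C : vertex_cover e C -> feasible e #|C|.+1.
Proof.
move=> vC; apply: (@connect_feasible _ (~: C) (~: C)).
  by have /and4P[a b c d] := legal_start C vC; apply/and4P; split=> //; apply: leqW.
have := connect_carry #|C|.+1 C set0 (~: C) vC (sub0set _) independent0.
rewrite setD0 setDv set0U; apply => //.
by apply/pred0P => y /=; apply/negP => /andP[/nbhdP[z]]; rewrite inE.
Qed.

(** * Extracting tightness from a schedule *)

(** The neighbours counted are off the left bank, and off [R] by independence, hence in the boat.
    Only [R :&: C] is missing there from [C], so at most [#|R :&: C|] outside items fit. *)
Lemma clears_bank C L R :
  [disjoint L & R] -> independent e R -> #|~: (L :|: R)| <= #|C| ->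
  [disjoint L & C] -> R :&: C != set0 -> clears C (R :&: C) (~: C :\: L).
Proof.
move=> dLR iR cB dLC RC; split; rewrite ?subsetIr //.
  exact: independentS (subsetIl _ _) iR.
have : nbhd e (R :&: C) :&: (~: C :\: L) \subset ~: (L :|: R) :\: C.
  apply/subsetP => y; rewrite !inE => /and3P[/nbhdP[x]].
  rewrite !inE => /andP[xR _] exy /negbTE-> /negbTE-> /=.
  by apply/negP => yR; move/independentP: iR => /(_ x y xR yR); rewrite exy.
move=> /subset_leq_card h; apply: leq_trans h _.
have : #|C :\: ~: (L :|: R)| = #|R :&: C|.
  apply: eq_card => y; have := pred0P dLC y; rewrite /= !inE.
  by do 3!case: (_ \in _).
by have := cardsID C (~: (L :|: R)); have := cardsID (~: (L :|: R)) C; rewrite setIC; lia.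
Qed.

(** Common neighbours of the two sets can be on neither bank, so they fill boat places left by the
    items of [C] ashore. *)
Lemma tight_banks C L R :
  independent e L -> independent e R -> [disjoint L & R] ->
  #|~: (L :|: R)| <= #|C| ->
  L :&: C != set0 -> R :&: C != set0 -> tight C.
Proof.
move=> iL iR dLR cB L0 R0; exists (L :&: C), (R :&: C).
split; rewrite ?L0 ?R0 ?subsetIr //; try by apply: independentS (subsetIl _ _) _.
apply: leq_trans (_ : #|~: (L :|: R) :\: C| <= _).
  apply/subset_leq_card/subsetP => y; rewrite !inE.
  move=> /andP[/andP[/nbhdP[x]]]; rewrite !inE => /andP[xL _] exy /negbTE->.
  move=> /andP[/nbhdP[z]]; rewrite !inE => /andP[zR _] ezy _ /=.
  rewrite negb_or; apply/andP; split; apply/negP => yM.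
    by move/independentP: iL => /(_ x y xL yM); rewrite exy.
  by move/independentP: iR => /(_ z y zR yM); rewrite ezy.
have : #|C :\: ~: (L :|: R)| <= #|L :&: C| + #|R :&: C|.
  apply: leq_trans (leq_card_setU _ _).
  apply/subset_leq_card/subsetP => y; rewrite !inE.
  by do 3!case: (_ \in _).
by have := cardsID C (~: (L :|: R)); have := cardsID (~: (L :|: R)) C; rewrite setIC; lia.
Qed.

(* When no item of [C] is on a bank, the boat is full with exactly [C]. *)
Lemma banks_cover C L R : #|~: (L :|: R)| <= #|C| ->
  [disjoint L & C] -> [disjoint R & C] -> L :|: R = ~: C.
Proof.
move=> cB dL dR; apply: (canRL setCK); apply/esym/eqP; rewrite eqEcard cB andbT.
apply/subsetP => x xC; have := pred0P dL x; have := pred0P dR x.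
by rewrite /= !inE xC !andbT => -> ->.
Qed.

Lemma tripartition_boat L B R : tripartition L B R -> B = ~: (L :|: R).
Proof.
move=> [/setP u /pred0P lb _ /pred0P br]; apply/setP => x.
have := u x; have := lb x; have := br x; rewrite /= !inE.
by do 3!case: (_ \in _).
Qed.

(** The first load is a cover, since what it leaves behind is independent. *)
Lemma feasible_cover b : feasible e b ->
  exists2 C, vertex_cover e C & #|C| <= b.
Proof.
move=> [s [L [B [R [so tri [st _] _ _]]]]].
have [|tp iL _ cB] := tri 1; first by case: s so {tri}.
exists (B 1) => //; rewrite vertex_cover_indepC; apply: independentS iL.
apply/subsetP => x; rewrite inE; move/setP/(_ x): st; rewrite !inE.
by case: (x \in B 1); rewrite ?orbF.
Qed.

(* Invariant: no item of [C] is on the left bank, and some [Y] clears everything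
   outside [C] that has left the left bank. *)
Lemma feasible_tight C : irreflexive e -> min_vertex_cover e C -> C != set0 ->
  feasible e #|C| -> tight C.
Proof.
move=> eI mC C0 [s [L [B [R [so tri [st en] ev od]]]]].
have s1 : 1 <= 1 <= s by case: s so {tri en ev od}.
have [tp1 iL1 _ cB1] := tri 1 s1.
have L1 : ~: B 1 = L 1.
  have [_ /pred0P d _ _] := tp1; apply/setP => x; have := d x.
  move/setP/(_ x): st; rewrite /= !inE.
  by do 2!case: (_ \in _).
have vB : vertex_cover e (B 1) by rewrite vertex_cover_indepC L1.
have [vC minC] := min_vertex_coverP _ mC.
have mB : min_vertex_cover e (B 1).
  by apply/min_vertex_coverP; split=> // D /minC; apply: leq_trans.
have cBC : #|C| = #|B 1| by apply/eqP; rewrite eqn_leq cB1 minC.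
apply: (tight_transfer _ _ mC mB).
have {C0} B0 : B 1 != set0 by rewrite -card_gt0 -cBC card_gt0.
have Ls : L s = set0.
  have [|[_ _ /pred0P dLR _] _ _ _] := tri s; first by rewrite leqnn andbT; case/andP: s1.
  have [|[_ /pred0P dLB _ _] _ _ _] := tri s; first by rewrite leqnn andbT; case/andP: s1.
  apply/setP => x; have := dLR x; have := dLB x; move/setP/(_ x): en.
  by rewrite /= !inE; do 3!case: (_ \in _).
rewrite {}cBC in tri; move: (B 1) B0 L1 tri {tp1 vB mB cB1} => D D0 L1 tri.
have {}tri k : 1 <= k <= s -> [/\ independent e (L k), independent e (R k),
    [disjoint L k & R k] & #|~: (L k :|: R k)| <= #|D|].
  move=> /tri[tp ? ?]; rewrite (tripartition_boat _ _ _ tp).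
  by case: tp.
have [//|ntight] := pselect (tight D).
suff inv k : k < s -> [disjoint L k.+1 & D] /\ exists Y, clears D Y (~: D :\: L k.+1).
  (* Since [L s] is empty, [Y] clears all of [~: D], and it trivially clears the empty remainder. *)
  have [|_ [Y]] := inv s.-1; first by case/andP: s1; lia.
  rewrite prednK; last by case/andP: s1.
  rewrite Ls setD0 => cY; apply: (clears_tight D (~: D) Y Y) => //.
  by rewrite setDv; case: cY => *; split; rewrite // setI0 cards0.
elim: k => [_|k IH ks].
  rewrite -L1 setDv -setI_eq0 setIC setICr; split=> //.
  (* Nothing outside [D] has left yet, so any single item of [D] serves as [Y]. *)
  have [x xD] := set0Pn _ D0; exists [set x]; split.
  - by apply/set0Pn; exists x; rewrite inE.
  - by rewrite sub1set.
  - exact: independent1.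
  - by rewrite setI0 cards0.
have [dL [Y cY]] := IH (ltnW ks).
have [ke|ko] := boolP (odd k.+1).
  have [||-> _] := ev k.+2; [lia | lia | by split=> //; exists Y].
have [||ER _] := od k.+2; [lia | lia | rewrite /= in ER].
have [|iL1k iR1k dLR1 cB1] := tri k.+1; first lia.
have [|iL2k iR2k dLR2 cB2] := tri k.+2; first lia.
rewrite -{}ER in iR1k dLR1 cB1.
have [L0|L0] := eqVneq (L k.+2 :&: D) set0; last first.
  have [R0|R0] := eqVneq (R k.+2 :&: D) set0; last first.
    by case: ntight; apply: (tight_banks D (L k.+2) (R k.+2)).
  (* At [k.+1] no item of [D] is ashore, so the banks make up [~: D]. What [Y] has not cleared is
     [L k.+1], and [L k.+2 :&: D] clears it, with the banks in exchanged roles. *)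
  case: ntight; apply: (clears_tight D (~: D :\: L k.+1) Y (L k.+2 :&: D)) => //.
  have dR : [disjoint R k.+2 & D] by rewrite -setI_eq0 R0.
  suff -> : ~: D :\: (~: D :\: L k.+1) = ~: D :\: R k.+2.
    by apply: clears_bank; rewrite // 1?disjoint_sym // setUC.
  rewrite -(banks_cover _ _ _ cB1 dL dR); apply/setP => x.
  have := pred0P dLR1 x; rewrite /= !inE.
  by do 2!case: (_ \in _).
have dL2 : [disjoint L k.+2 & D] by rewrite -setI_eq0 L0.
split=> //; have [R0|R0] := eqVneq (R k.+2 :&: D) set0; last first.
  by exists (R k.+2 :&: D); apply: clears_bank.
have dR : [disjoint R k.+2 & D] by rewrite -setI_eq0 R0.
(* Both positions have banks making up [~: D] and share the right bank. *)
exists Y; suff -> : L k.+2 = L k.+1 by [].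
have := banks_cover _ _ _ cB1 dL dR; rewrite -(banks_cover _ _ _ cB2 dL2 dR).
move=> /setP E; apply/setP => x; have := E x; rewrite !inE.
have := pred0P dLR1 x; have := pred0P dLR2 x => /=.
by do 3!case: (_ \in _).
Qed.

End Graph.

Theorem theorem2p6 (V : finType) (e : rel V)
    (e_sym : symmetric e) (e_irr : irreflexive e)
    (C : {set V}) (C_min : min_vertex_cover e C) :
  class_two e <->
  (forall S T : {set V},
     S != set0 -> T != set0 ->
     S \subset C -> T \subset C ->
     independent e S -> independent e T ->
     #|nbhd_in e (~: C) S :&: nbhd_in e (~: C) T| > #|S| + #|T|).
Proof.
have [vC minC] := min_vertex_coverP _ _ _ C_min.
rewrite /class_two (card_min_vertex_cover _ _ _ C_min) /alcuin_number.
have not_tight : ~ tight V e C <-> (forall S T : {set V},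
     S != set0 -> T != set0 -> S \subset C -> T \subset C ->
     independent e S -> independent e T ->
     #|nbhd_in e (~: C) S :&: nbhd_in e (~: C) T| > #|S| + #|T|).
  split=> [nt S T S0 T0 SC TC iS iT|h [S [T [/andP[S0 T0] /andP[SC TC] iS iT]]]].
    rewrite ltnNge; apply/negP => le; apply: nt; exists S, T.
    by rewrite S0 T0 SC TC.
  by rewrite leqNgt h.
rewrite -not_tight; case: ex_minnP => m /andP[m0 /asboolP fm] min_m.
split=> [mE tC|nt].
  have C0 : 0 < #|C|.
    case: tC => S [T [/andP[S0 _] /andP[SC _] _ _ _]].
    by rewrite (leq_trans _ (subset_leq_card SC)) // card_gt0.
  have := min_m #|C|; rewrite C0 mE ltnn /=; move=> H; apply/notF/H/asboolP.
  exact: tight_feasible.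
apply/eqP; rewrite eqn_leq; apply/andP; split.
  by apply: min_m; apply/asboolP; apply: cover_feasibleS.
have [D vD Dm] := feasible_cover _ _ _ fm.
(* If [m] equals [#|C|], the schedule makes [C] tight; positivity of [m] gives the nonempty
   cover. *)
have := leq_trans (minC D vD) Dm; rewrite leq_eqVlt => /orP[/eqP mC|//].
case: nt; apply: feasible_tight => //; last by rewrite mC.
by rewrite -card_gt0 mC.
Qed.
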